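(* Let $\Lambda$ be a finite dimensional algebra over a field and $k\ge1$ an integer. Then $$k\text{-}\operatorname{edell}\Lambda\le k\text{-}\operatorname{sub\text{-}ddell}\Lambda\le k\text{-}\operatorname{dell}\Lambda .$$
   Context: Modules are right $\Lambda$-modules; $\mathrm{mod}\,\Lambda$ denotes the category of finitely generated ones. $\mathbb N$ is the set of nonnegative integers; the infimum of the empty set is $+\infty$. $\Omega M$ is the kernel of a projective cover of $M$, $\Omega^0M=M$, $\Omega^{n+1}M=\Omega(\Omega^nM)$. ''$A$ is a direct summand of $B$ up to projective summands'' means that $A$ is isomorphic to a direct summand of $B\oplus P$ for some projective $P$. For an integer $j\ge0$, $j\text{-}\operatorname{dell}M$ is the infimum of all $n\in\mathbb N$ such that $\Omega^nM$ is a direct summand of $\Omega^{n+j}N$ up to projective summands for some $N\in\mathrm{mod}\,\Lambda$ (so $0\text{-}\operatorname{dell}M=0$ always). $k\text{-}\operatorname{edell}M$ is the infimum of all $n\in\mathbb N$ such that for every integer $k'\ge1$ and every right $\Lambda$-module $X$ of injective dimension $\mathrm{id}\,X=n+k-1+k'$ one has $\mathrm{Ext}_\Lambda^{n+k'}(M,X)=0$. $k\text{-}\operatorname{sub\text{-}ddell}M$ is the infimum of all $m\in\mathbb N$ for which there exist an integer $0\le n\le k$ and an exact sequence $0\to M\to D_0\to D_1\to\cdots\to D_{n-1}\to D_n\to0$ in $\mathrm{mod}\,\Lambda$ with $(k-i)\text{-}\operatorname{dell}D_i\le i+m$ for $i=0,1,\dots,n$. For each of these three invariants, the value on $\Lambda$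 is the supremum of the values on the simple right $\Lambda$-modules. *)

(* Defs.v *)
From HB Require Import structures.
From mathcomp Require Import all_boot all_order all_algebra falgebra.
From mathcomp Require Import boolp classical_sets constructive_ereal.

Set Implicit Arguments.
Unset Strict Implicit.
Unset Printing Implicit Defensive.

Import Order.TTheory GRing.Theory.
Local Open Scope ring_scope.
Local Open Scope classical_set_scope.

(* Right modules over A are left modules over the converse ring A^c: for
   x : M and a : A, the product x a is written a *: x. *)
Notation rmodType A := (lmodType (A%type^c)).

(* N ∪ {+oo} is embedded in \bar int. *)
Definition enat (n : nat) : \bar int := (n%:Z)%:E.

Definition inf_nat (Q : nat -> Prop) : \bar int :=
  infimum +oo%E [set enat n | n in Q].

Section Modules.
Variable R : nzRingType.

Definition is_zero (M : lmodType R) : Prop := forall x : M, x = 0.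

Definition exact (U V W : lmodType R)
    (f : {linear U -> V}) (g : {linear V -> W}) : Prop :=
  forall y : V, g y = 0 <-> exists x : U, f x = y.

Definition surjective (U V : lmodType R) (f : {linear U -> V}) : Prop :=
  forall y : V, exists x : U, f x = y.

Definition isomorphic (U V : lmodType R) : Prop :=
  exists f : {linear U -> V}, bijective f.

Definition fin_gen (M : lmodType R) : Prop :=
  exists (n : nat) (g : 'I_n -> M),
    forall x : M, exists c : 'I_n -> R, x = \sum_(i < n) c i *: g i.

Definition simple_module (S : lmodType R) : Prop :=
  ~ is_zero S /\
  forall U : {pred S}, submod_closed U ->
    (forall x, x \in U -> x = 0) \/ (forall x, x \in U).

Definition projective (P : lmodType R) : Prop :=
  forall (U V : lmodType R) (g : {linear U -> V}) (f : {linear P -> V}),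
    surjective g -> exists h : {linear P -> U}, forall x, g (h x) = f x.

Definition injective_module (I : lmodType R) : Prop :=
  forall (U V : lmodType R) (g : {linear U -> V}) (f : {linear U -> I}),
    injective g -> exists h : {linear V -> I}, forall x, h (g x) = f x.

Definition superfluous_kernel (P M : lmodType R) (p : {linear P -> M}) : Prop :=
  forall U : {pred P}, submod_closed U ->
    (forall x, exists u v, [/\ u \in U, p v = 0 & x = u + v]) ->
    forall x, x \in U.

Definition projective_cover (P M : lmodType R) (p : {linear P -> M}) : Prop :=
  [/\ projective P, surjective p & superfluous_kernel p].

(* Syzygies are only defined up to isomorphism, hence are given as relations:
   [is_syzygy n M K] means that K is (isomorphic to) Omega^n M. *)
Definition is_Omega (M K : lmodType R) : Prop :=
  exists (P : lmodType R) (p : {linear P -> M}) (i : {linear K -> P}),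
    [/\ projective_cover p, injective i & exact i p].

Fixpoint is_syzygy (n : nat) (M K : lmodType R) : Prop :=
  if n is n'.+1 then exists2 L : lmodType R, is_syzygy n' M L & is_Omega L K
  else isomorphic M K.

Definition summand_upto_proj (U V : lmodType R) : Prop :=
  exists P C : lmodType R,
    projective P /\ isomorphic (U * C)%type (V * P)%type.

(* 0 -> M -> D 0 -> D 1 -> ... *)
Definition coresolution (M : lmodType R) (D : nat -> lmodType R)
    (e : {linear M -> D 0%N}) (d : forall i, {linear D i -> D i.+1}) : Prop :=
  [/\ injective e, exact e (d 0%N) & forall i, exact (d i) (d i.+1)].

(* 0 -> M -> D 0 -> ... -> D n -> 0, padded by zero modules in degrees > n;
   exactness at D n then says that the last map is onto. *)
Definition finite_coresolution (n : nat) (M : lmodType R)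
    (D : nat -> lmodType R)
    (e : {linear M -> D 0%N}) (d : forall i, {linear D i -> D i.+1}) : Prop :=
  coresolution e d /\ forall i, (n < i)%N -> is_zero (D i).

Definition injdim (X : lmodType R) : \bar int :=
  inf_nat (fun n => exists (I : nat -> lmodType R) (e : {linear X -> I 0%N})
                           (d : forall i, {linear I i -> I i.+1}),
    finite_coresolution n e d /\ forall i, injective_module (I i)).

Definition projective_resolution (M : lmodType R) (P : nat -> lmodType R)
    (e : {linear P 0%N -> M}) (d : forall i, {linear P i.+1 -> P i}) : Prop :=
  [/\ forall i, projective (P i), surjective e, exact (d 0%N) e
    & forall i, exact (d i.+1) (d i)].

Section HomComplex.
Variables (P : nat -> lmodType R) (d : forall i, {linear P i.+1 -> P i}).
Variable X : lmodType R.

Definition cocycle (i : nat) (f : {linear P i -> X}) : Prop :=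
  forall x, f (d i x) = 0.

Definition coboundary (i : nat) : {linear P i -> X} -> Prop :=
  match i with
  | 0%N => fun f => forall x, f x = 0
  | j.+1 => fun f => exists g : {linear P j -> X}, forall x, f x = g (d j x)
  end.

End HomComplex.

(* Ext^i(M, X) = 0, where Ext^i(M, X) is the i-th cohomology of Hom(P, X) for
   a projective resolution P of M; the choice of P is immaterial. *)
Definition Ext_eq0 (i : nat) (M X : lmodType R) : Prop :=
  forall (P : nat -> lmodType R) (e : {linear P 0%N -> M})
         (d : forall i, {linear P i.+1 -> P i}),
    projective_resolution e d ->
    forall f : {linear P i -> X}, cocycle d f -> coboundary d f.

Definition dell (j : nat) (M : lmodType R) : \bar int :=
  inf_nat (fun n => exists N K L : lmodType R,
    [/\ fin_gen N, is_syzygy n M K, is_syzygy (n + j)%N N L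
      & summand_upto_proj K L]).

Definition edell (k : nat) (M : lmodType R) : \bar int :=
  inf_nat (fun n => forall (k' : nat) (X : lmodType R), (1 <= k')%N ->
    injdim X = enat (n + k - 1 + k')%N -> Ext_eq0 (n + k')%N M X).

Definition sub_ddell (k : nat) (M : lmodType R) : \bar int :=
  inf_nat (fun m => exists (n : nat) (D : nat -> lmodType R)
                           (e : {linear M -> D 0%N})
                           (d : forall i, {linear D i -> D i.+1}),
    [/\ (n <= k)%N, finite_coresolution n e d, forall i, fin_gen (D i)
      & forall i, (i <= n)%N -> (dell (k - i)%N (D i) <= enat (i + m)%N)%E]).

Definition sup_simples (v : lmodType R -> \bar int) : \bar int :=
  supremum -oo%E [set x | exists2 S : lmodType R, simple_module S & x = v S].

End Modules.

Section Algebra.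
Variables (F : fieldType) (A : falgType F).

Definition alg_dell (k : nat) : \bar int :=
  sup_simples (fun S : rmodType A => dell k S).

Definition alg_edell (k : nat) : \bar int :=
  sup_simples (fun S : rmodType A => edell k S).

Definition alg_sub_ddell (k : nat) : \bar int :=
  sup_simples (fun S : rmodType A => sub_ddell k S).

End Algebra.

(* Main.v *)
(** Fix an injective coresolution [I] of [X] of length [q = m + k - 1 + k'],
    and compute [Ext^j(-, X)] as the [j]-th cohomology of [Hom(-, I)], so that
    [Ext^(q+1)(-, X) = 0].  If [Omega^p D] is a summand of
    [Omega^(p + k - i) N] up to projectives, with [p <= i + m], dimension
    shifting turns [Ext^(m+k'+i)(D, X)] into a summand of
    [Ext^(m+k'+k)(N, X) = Ext^(q+1)(N, X) = 0].  In a coresolution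
    [0 -> M -> D_0 -> ... -> D_n -> 0] with [n <= k] and
    [(k-i)-dell D_i <= i + m], all [Ext^(m+k'+i)(D_i, X)] therefore vanish, and
    the long exact sequences give [Ext^(m+k')(M, X) = 0].  The second
    inequality uses the coresolution [0 -> M -> M -> 0]. *)

Require Import Defs.
From HB Require Import structures.
From mathcomp Require Import all_boot all_order all_algebra falgebra.
From mathcomp Require Import boolp classical_sets constructive_ereal.

Set Implicit Arguments.
Unset Strict Implicit.
Unset Printing Implicit Defensive.

Import Order.TTheory GRing.Theory.
Local Open Scope ring_scope.

(** * Infima of sets of naturals in [\bar int], and suprema of such infima *)

Section InfimaOfNaturals.

Lemma enat_le (m n : nat) : (enat m <= enat n)%E = (m <= n)%N.
Proof. by rewrite /enat lee_fin. Qed.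

Variant inf_nat_spec (Q : nat -> Prop) : \bar int -> Prop :=
  | InfNatMin n of Q n & (forall m, Q m -> (n <= m)%N) : inf_nat_spec Q (enat n)
  | InfNatEmpty of (forall n, ~ Q n) : inf_nat_spec Q +oo%E.

(** By well-ordering a nonempty set of naturals attains its infimum, so a finite value of an
    invariant always comes with a witness. *)
Lemma inf_natP (Q : nat -> Prop) : inf_nat_spec Q (inf_nat Q).
Proof.
have [exQ|nexQ] := pselect (exists n, Q n); last first.
  suff -> : inf_nat Q = +oo%E.
    by apply: InfNatEmpty => n Qn; apply: nexQ; exists n.
  rewrite /inf_nat /infimum ifT //; apply/eqP; rewrite -subset0 => x [n Qn _].
  by apply: nexQ; exists n.
have exQb : exists n, `[< Q n >] by case: exQ => n Qn; exists n; apply/asboolP.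
case: (ex_minnP exQb) => n /asboolP Qn minn.
have minQ m : Q m -> (n <= m)%N by move=> Qm; apply: minn; apply/asboolP.
suff -> : inf_nat Q = enat n by apply: InfNatMin.
rewrite /inf_nat /infimum ifF; last first.
  by apply/negbTE/set0P; exists (enat n), n.
have inf_n : infimums [set enat n | n in Q]%classic (enat n).
  split=> [_ [m Qm <-]|y]; first by rewrite enat_le; apply: minQ.
  by apply; exists n.
apply: xget_unique => // y [y_lb y_glb]; apply/eqP; rewrite eq_le.
by rewrite (y_lb (enat n)) ?y_glb //; [exact: inf_n.1 | exists n].
Qed.

Lemma inf_nat_le (Q : nat -> Prop) n : Q n -> (inf_nat Q <= enat n)%E.
Proof. by case: inf_natP => [m _ minm /minm|nQ /nQ]; rewrite ?enat_le. Qed.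

Lemma inf_nat_leP (Q : nat -> Prop) n :
  (inf_nat Q <= enat n)%E -> exists2 m, Q m & (m <= n)%N.
Proof.
case: inf_natP => [m Qm _|_]; first by rewrite enat_le; exists m.
by rewrite leye_eq.
Qed.

(** [supremum] picks a least upper bound only if one exists. Here it is [+oo] if no natural bounds
    [B], and the least natural bound otherwise. *)
Lemma supremums_inf_nat (B : set (\bar int)) :
  (forall x, B x -> exists Q, x = inf_nat Q) -> (B !=set0)%classic ->
  (supremums B !=set0)%classic.
Proof.
move=> Bnat [x0 Bx0].
have [[b b_ub]|unbounded] := pselect (exists b, ubound B (enat b)); last first.
  exists +oo%E; split=> [x _|y y_ub]; first by rewrite leey.
  case: y y_ub => [[b|b]||] // y_ub.
  - by case: unbounded; exists b.
  - case: unbounded; exists 0%N => x /y_ub /le_trans; apply.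
    by rewrite lee_fin.
  - by case: unbounded; exists 0%N => x /y_ub /le_trans; apply; rewrite leNye.
have exb : exists b, `[< ubound B (enat b) >] by exists b; apply/asboolP.
case: (ex_minnP exb) => c /asboolP c_ub minc.
exists (enat c); split=> // y y_ub.
(* [c] is least among natural bounds only; a negative upper bound is excluded because [B] has a
   nonnegative element. *)
have y_ge0 : (enat 0 <= y)%E.
  apply: le_trans (y_ub _ Bx0); have [Q ->] := Bnat _ Bx0.
  by case: inf_natP => [n _ _|_]; [rewrite enat_le | rewrite leey].
case: y y_ub y_ge0 => [[n|n]||] y_ub; rewrite ?lee_fin ?leey // => _.
by rewrite lez_nat; apply: minc; apply/asboolP.
Qed.

End InfimaOfNaturals.

Section Modules.
Variable R : nzRingType.
Implicit Types U V W M N K P X S : lmodType R.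

Lemma le_sup_simples (v w : lmodType R -> \bar int) :
  (forall M, exists Q, w M = inf_nat Q) ->
  (forall S, simple_module S -> (v S <= w S)%E) ->
  (sup_simples v <= sup_simples w)%E.
Proof.
move=> wnat le_vw; rewrite {1}/sup_simples /supremum.
case: ifPn => [_|/set0P [_ [S0 simS0 _]]]; first by rewrite leNye.
(* If the values of [v] had no least upper bound, [supremum] would return its default [-oo]. *)
case: xgetP => [x _ [_ x_lub]|_]; last by rewrite leNye.
apply: x_lub => _ [S simS ->]; apply: le_trans (le_vw S simS) _.
apply: ge_supremum_Nmem; last by exists S.
apply: supremums_inf_nat => [_ [T _ ->]|]; first exact: wnat.
by exists (w S0), S0.
Qed.

(** * Factoring linear maps, and kernels as modules *)

Lemma linear_of_fun U V (h : U -> V) :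
  linear h -> exists h' : {linear U -> V}, forall x, h' x = h x.
Proof.
move=> lin_h.
by exists (HB.pack_for {linear U -> V} h (GRing.isLinear.Build R U V _ h lin_h)).
Qed.

Lemma factor_surjective U V W (p : {linear U -> V}) (g : {linear U -> W}) :
  surjective p -> (forall x, p x = 0 -> g x = 0) ->
  exists h : {linear V -> W}, forall x, h (p x) = g x.
Proof.
move=> /choice [s ps] g0.
have gE x y : p x = p y -> g x = g y.
  move=> pxy; apply/eqP; rewrite -subr_eq0 -linearB; apply/eqP/g0.
  by rewrite linearB pxy subrr.
have [|h hE] := @linear_of_fun V W (g \o s).
  by move=> a x y /=; rewrite -linearP; apply: gE; rewrite linearP !ps.
by exists h => x; rewrite hE; apply: gE; rewrite ps.
Qed.

Lemma factor_injective U V W (i : {linear U -> V}) (g : {linear W -> V}) :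
  injective i -> (forall x, exists y, i y = g x) ->
  exists h : {linear W -> U}, forall x, i (h x) = g x.
Proof.
move=> inj_i /choice [s is_].
have [|h hE] := @linear_of_fun W U s.
  by move=> a x y; apply: inj_i; rewrite linearP !is_ linearP.
by exists h => x; rewrite hE.
Qed.

Section Kernel.
Variables (V W : lmodType R) (f : {linear V -> W}).

Definition in_kernel : pred V := fun x => f x == 0.

Lemma in_kernel_closed : submod_closed in_kernel.
Proof.
split=> [|a x y]; rewrite !unfold_in ?linear0 // linearP.
by move=> /eqP-> /eqP->; rewrite scaler0 addr0.
Qed.

HB.instance Definition _ := GRing.isSubmodClosed.Build R V in_kernel
  (GRing.submod_closed_semi in_kernel_closed).

(** A subtype, so that the kernel is itself an [lmodType] and can be a term of an exact sequence. *)
Record kernel := Kernel { kernel_val : V; _ : kernel_val \in in_kernel }.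
HB.instance Definition _ := [isSub for kernel_val].
HB.instance Definition _ := [Choice of kernel by <:].
HB.instance Definition _ := [SubChoice_isSubLmodule of kernel by <:].

Definition kernel_incl : {linear kernel -> V} := val.

Lemma kernel_incl_inj : injective kernel_incl.
Proof. exact: val_inj. Qed.

Lemma kernel_inclK (x : kernel) : f (kernel_incl x) = 0.
Proof. exact/eqP/(valP x). Qed.

Lemma exact_kernel : exact kernel_incl f.
Proof.
move=> y; split=> [fy0|[x <-]]; last exact: kernel_inclK.
have yK : y \in in_kernel by apply/eqP.
by exists (Kernel yK).
Qed.

Lemma kernel_lift U (g : {linear U -> V}) : (forall x, f (g x) = 0) ->
  exists h : {linear U -> kernel}, forall x, kernel_incl (h x) = g x.
Proof.
move=> fg0; apply: factor_injective; first exact: kernel_incl_inj.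
by move=> x; apply/exact_kernel.
Qed.

End Kernel.

(** Serves to cut long exact sequences into short exact ones. *)
Lemma corestrict_exact U V W (f : {linear U -> V}) (g : {linear V -> W}) :
  exact f g -> exists h : {linear U -> kernel g},
    (forall x, kernel_incl g (h x) = f x) /\ surjective h.
Proof.
move=> fg; have [|h hE] := @kernel_lift _ _ g _ f.
  by move=> x; apply/fg; exists x.
exists h; split=> // y; have /fg[x fx] := kernel_inclK y.
by exists x; apply: kernel_incl_inj; rewrite hE.
Qed.

Lemma projective_lift_exact P U V W (f : {linear U -> V}) (g : {linear V -> W})
    (t : {linear P -> V}) :
  projective P -> exact f g -> (forall x, g (t x) = 0) ->
  exists s : {linear P -> U}, forall x, f (s x) = t x.
Proof.
move=> projP fg gt0; have [f' [f'E f'surj]] := corestrict_exact fg.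
have [t' t'E] := kernel_lift gt0; have [s sE] := projP _ _ _ t' f'surj.
by exists s => x; rewrite -f'E sE t'E.
Qed.

(** * Vanishing of Ext, computed from an injective coresolution of [X] *)

Section ExtByInjectives.
Variables (X : lmodType R) (I : nat -> lmodType R) (e : {linear X -> I 0%N}).
Variable d : forall i, {linear I i -> I i.+1}.
Hypotheses (resX : coresolution e d) (injI : forall i, injective_module (I i)).

Let exd i : exact (d i) (d i.+1). Proof. by case: resX. Qed.
Let dd i x : d i.+1 (d i x) = 0. Proof. by apply/exd; exists x. Qed.

(* The vanishing of [Ext^(j+1)(M, X)]: note the shift of the index. *)
Definition extS_eq0 (j : nat) (M : lmodType R) : Prop :=
  forall g : {linear M -> I j.+1}, (forall x, d j.+1 (g x) = 0) ->
  exists h : {linear M -> I j}, forall x, d j (h x) = g x.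

Lemma extS_eq0_projective j P : projective P -> extS_eq0 j P.
Proof. by move=> projP g; apply: projective_lift_exact. Qed.

Lemma extS_eq0_beyond j M : is_zero (I j.+1) -> extS_eq0 j M.
Proof.
move=> I0 g _; exists (\0 : {linear M -> I j}) => x.
by rewrite [RHS]I0 [LHS]I0.
Qed.

Lemma extS_eq0_zero j M : is_zero M -> extS_eq0 j M.
Proof.
move=> M0 g _; exists (\0 : {linear M -> I j}) => x.
by rewrite (M0 x) !linear0.
Qed.

Lemma extS_eq0_retract j U V (s : {linear U -> V}) (r : {linear V -> U}) :
  cancel s r -> extS_eq0 j V -> extS_eq0 j U.
Proof.
move=> sK extV g dg0; have [|h hE] := extV (g \o r); first by move=> x /=.
by exists (h \o s) => x /=; rewrite hE /= sK.
Qed.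

Lemma extS_eq0_iso j U V : isomorphic U V -> extS_eq0 j U <-> extS_eq0 j V.
Proof.
move=> [f [f' fK f'K]].
have [|h hE] := @linear_of_fun V U f'.
  by move=> a x y; apply: (can_inj fK); rewrite linearP !f'K.
split; [apply: (@extS_eq0_retract _ _ _ h f) => x; rewrite hE; exact: f'K
       |apply: (@extS_eq0_retract _ _ _ f h) => x; rewrite hE; exact: fK].
Qed.

Lemma extS_eq0_prod j U V : extS_eq0 j U -> extS_eq0 j V ->
  extS_eq0 j (U * V)%type.
Proof.
move=> extU extV g dg0.
have [|inU inUE] := @linear_of_fun U (U * V)%type (fun x => (x, 0)).
  by move=> a x y; congr (_, _); rewrite /= scaler0 addr0.
have [|inV inVE] := @linear_of_fun V (U * V)%type (fun x => (0, x)).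
  by move=> a x y; congr (_, _); rewrite /= scaler0 addr0.
have [|h hE] := extU (g \o inU); first by move=> x /=.
have [|h' h'E] := extV (g \o inV); first by move=> x /=.
exists ((h \o fst) \+ (h' \o snd)) => -[x y] /=.
rewrite linearD hE h'E /= -linearD inUE inVE; congr (g (_, _)).
  exact: addr0.
exact: add0r.
Qed.

Lemma extS_eq0_summand j U V : summand_upto_proj U V ->
  extS_eq0 j V -> extS_eq0 j U.
Proof.
move=> [P [C [projP iso]]] extV.
have extUC : extS_eq0 j (U * C)%type.
  apply/(extS_eq0_iso j iso); apply: extS_eq0_prod => //.
  exact: extS_eq0_projective.
have [|inU inUE] := @linear_of_fun U (U * C)%type (fun x => (x, 0)).
  by move=> a x y; congr (_, _); rewrite /= scaler0 addr0.
apply: (@extS_eq0_retract j _ _ inU (fst : {linear (U * C)%type -> U})) extUC.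
by move=> x; rewrite inUE.
Qed.

(** * Pieces of the long exact Ext sequence of [0 -> K -> P -> M -> 0] *)

Section ShortExact.
Variables (K P M : lmodType R) (i : {linear K -> P}) (p : {linear P -> M}).
Hypotheses (inj_i : injective i) (ip : exact i p) (surj_p : surjective p).

Let pi0 x : p (i x) = 0. Proof. by apply/ip; exists x. Qed.

(** Exactness of [Ext^(j+1)(P, X) -> Ext^(j+1)(K, X) -> Ext^(j+2)(M, X)]. The differential of an
    extension [G] of [g] to [P] kills [K] and descends to a cocycle on [M]; correcting [G] by a
    primitive of it gives a cocycle on [P]. *)
Lemma extS_eq0_sub j : extS_eq0 j P -> extS_eq0 j.+1 M -> extS_eq0 j K.
Proof.
move=> extP extM g dg0; have [G GE] := injI g inj_i.
have [|g' g'E] := @factor_surjective _ _ _ p (d j.+1 \o G) surj_p.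
  by move=> x /ip[y <-] /=; rewrite GE dg0.
have [|h hE] := extM g'.
  by move=> y; have [x <-] := surj_p y; rewrite g'E /= dd.
have [|u uE] := extP (G \- (h \o p)).
  by move=> x /=; rewrite linearB hE g'E subrr.
by exists (u \o i) => x /=; rewrite uE /= pi0 linear0 subr0 GE.
Qed.

(** Exactness of [Ext^(j+1)(K, X) -> Ext^(j+2)(M, X) -> Ext^(j+2)(P, X) = 0]. A primitive [G] of
    [g \o p] restricts to a cocycle on [K]; subtracting a coboundary on [P] makes it vanish on [K],
    so it descends to [M]. *)
Lemma extS_eq0_quotient j : projective P -> extS_eq0 j K -> extS_eq0 j.+1 M.
Proof.
move=> projP extK g dg0.
have [|G GE] := @projective_lift_exact _ _ _ _ _ _ (g \o p) projP (@exd j.+1).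
  by move=> x /=.
have [|u uE] := extK (G \o i).
  by move=> x /=; rewrite GE /= pi0 linear0.
have [U' U'E] := injI u inj_i.
have [|h hE] := @factor_surjective _ _ _ p (G \- (d j \o U')) surj_p.
  by move=> x /ip[y <-] /=; rewrite U'E uE /= subrr.
exists h => y; have [x <-] := surj_p y.
by rewrite hE /= linearB dd subr0 GE.
Qed.

(* The connecting map [Hom(K, X) -> Ext^1(M, X)] vanishes. *)
Lemma extS_eq0_extend (f : {linear K -> X}) : extS_eq0 0 M ->
  exists u : {linear P -> X}, forall x, u (i x) = f x.
Proof.
case: resX => inj_e ex_e _ extM.
have [G GE] := injI (e \o f) inj_i.
have de0 x : d 0%N (e x) = 0 by apply/ex_e; exists x.
have [|g' g'E] := @factor_surjective _ _ _ p (d 0%N \o G) surj_p.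
  by move=> x /ip[y <-] /=; rewrite GE /= de0.
have [|h hE] := extM g'.
  by move=> y; have [x <-] := surj_p y; rewrite g'E /= dd.
have [|u uE] := @factor_injective _ _ _ e (G \- (h \o p)) inj_e.
  by move=> x; apply/ex_e => /=; rewrite linearB hE g'E subrr.
by exists u => x; apply: inj_e; rewrite uE /= pi0 linear0 subr0 GE.
Qed.

End ShortExact.

Lemma extS_eq0_Omega j M K : is_Omega M K -> extS_eq0 j.+1 M <-> extS_eq0 j K.
Proof.
move=> [P [p [i [[projP surj_p _] inj_i ip]]]]; split.
  by apply: extS_eq0_sub ip surj_p _ _ => //; apply: extS_eq0_projective.
exact: extS_eq0_quotient ip surj_p _ projP.
Qed.

Lemma extS_eq0_syzygy n j M K : is_syzygy n M K ->
  extS_eq0 (j + n) M <-> extS_eq0 j K.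
Proof.
elim: n j K => [|n IHn] j K /=; first by rewrite addn0; apply: extS_eq0_iso.
move=> [L synL OmK]; rewrite addnS -addSn (IHn _ _ synL).
exact: extS_eq0_Omega.
Qed.

(** Passes from injective to projective resolutions. Dropping [P 0] leaves a projective resolution
    of the first syzygy [kernel eP], which lowers the degree by one until degree 1. *)
Lemma extS_eq0_Ext j M : extS_eq0 j M -> Ext_eq0 j.+1 M X.
Proof.
elim: j M => [|j IHj] M extM P eP dP [projP surj_eP ex0 exS] f fd0.
  have [p [pE psurj]] := corestrict_exact ex0.
  (* A cocycle on [P 1] kills the image of [P 2], hence descends to [kernel eP]; extending it to
     [P 0] makes it a coboundary. *)
  have [|phi phiE] := @factor_surjective _ _ _ p f psurj.
    move=> x px0; suff /exS[y <-] : dP 0%N x = 0 by apply: fd0.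
    by rewrite -pE px0 linear0.
  have [u uE] := extS_eq0_extend (@kernel_incl_inj _ _ eP)
    (@exact_kernel _ _ eP) surj_eP phi extM.
  by exists u => x; rewrite -pE uE phiE.
have [p [pE psurj]] := corestrict_exact ex0.
have extK : extS_eq0 j (kernel eP).
  apply: extS_eq0_sub (@kernel_incl_inj _ _ eP) (@exact_kernel _ _ eP) surj_eP
    _ _ extM.
  exact: extS_eq0_projective.
have res' : @projective_resolution R (kernel eP) (fun i => P i.+1) p
    (fun i => dP i.+1).
  split=> // y; rewrite -exS -pE; split=> [->|]; first exact: linear0.
  by rewrite -(linear0 (kernel_incl eP)) => /kernel_incl_inj.
have [g gE] := IHj _ extK _ _ _ res' f fd0.
by exists g.
Qed.

Lemma extS_eq0_coresolution n j M (D : nat -> lmodType R)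
    (eD : {linear M -> D 0%N}) (dD : forall i, {linear D i -> D i.+1}) :
  finite_coresolution n eD dD ->
  (forall i, (i <= n)%N -> extS_eq0 (j + i) (D i)) -> extS_eq0 j M.
Proof.
move=> [[inj_e ex_e ex_d] D0] extD.
(* Descending induction along [0 -> Z_i -> D_i -> Z_(i+1) -> 0], with [Z_i] the kernel of [dD i]. It
   starts from [Z_(n+1) = 0] and ends at [Z_0], isomorphic to [M]. *)
have extZ c i : (i + c = n.+1)%N -> extS_eq0 (j + i) (kernel (dD i)).
  elim: c i => [|c IHc] i icn.
    apply: extS_eq0_zero => x; apply: kernel_incl_inj.
    by rewrite [LHS]D0 ?[RHS]D0 // -icn addn0.
  have [p [pE psurj]] := corestrict_exact (ex_d i).
  apply: (extS_eq0_sub (@kernel_incl_inj _ _ (dD i)) _ psurj).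
  - move=> y; rewrite -exact_kernel -pE; split=> [->|]; first exact: linear0.
    by rewrite -(linear0 (kernel_incl (dD i.+1))) => /kernel_incl_inj.
  - by apply: extD; rewrite -ltnS -icn addnS ltnS leq_addr.
  - by rewrite -addnS; apply: IHc; rewrite addSnnS.
have [p [pE psurj]] := corestrict_exact ex_e.
have inj_p : injective p by move=> x y pxy; apply: inj_e; rewrite -!pE pxy.
have [s ps] := choice psurj.
apply/(@extS_eq0_iso j M (kernel (dD 0%N))).
  by exists p; exists s => x; [apply: inj_p; rewrite ps | exact: ps].
by rewrite -[j]addn0; apply: (extZ n.+1).
Qed.

Lemma extS_eq0_dell q j m D : is_zero (I q.+1) ->
  (dell j D <= enat m)%E -> (m + j <= q)%N -> extS_eq0 (q - j) D.
Proof.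
move=> I0 /inf_nat_leP[p [N [K [L [_ synK synL KL]]]] le_pm] le_mjq.
have le_pjq : (p + j <= q)%N by apply: leq_trans le_mjq; rewrite leq_add2r.
(* Shifting down by the [p] syzygies of [D] and up by the [p + j] syzygies of [N] lands exactly in
   index [q], that is, in [Ext^(q+1)(N, X)]. *)
have -> : (q - j = q - (p + j) + p)%N.
  by rewrite addnC [(p + j)%N]addnC subnDA subnKC // leq_subRL ?(addnC j) //;
     apply: leq_trans le_pjq; apply: leq_addl.
apply/(extS_eq0_syzygy _ synK); apply: (extS_eq0_summand KL).
apply/(extS_eq0_syzygy _ synL); rewrite subnK //.
exact: extS_eq0_beyond.
Qed.

End ExtByInjectives.

(** * The two inequalities for a single module *)

Lemma edell_le_sub_ddell k M : (1 <= k)%N -> (edell k M <= sub_ddell k M)%E.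
Proof.
move=> k_gt0; rewrite /sub_ddell.
case: inf_natP => [m|_]; last by rewrite leey.
move=> [n [D [eD [dD [le_nk resD _ dellD]]]]] _.
apply: inf_nat_le => k' X k'_gt0 idX.
have : (injdim X <= enat (m + k - 1 + k'))%E by rewrite idX.
move=> /inf_nat_leP[q [I [e [d [[resX I0] injI]]]] le_q].
(* Replacing [k'] by its predecessor matches the index shift of [extS_eq0]. *)
case: k' k'_gt0 le_q {idX} => // k' _ le_q.
rewrite addnS; apply: (extS_eq0_Ext resX injI).
apply: (extS_eq0_coresolution resX injI resD) => i le_in.
have le_ik := leq_trans le_in le_nk.
have -> : (m + k' + i = m + k' + k - (k - i))%N.
  by rewrite -addnBA ?leq_subr // subKn.
apply: (extS_eq0_dell resX injI _ (dellD i le_in)).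
  (* Since [k >= 1], the truncated [m + k - 1 + k'.+1] equals [m + k' + k], so the coresolution is
     zero in degree [(m + k' + k).+1]. *)
  apply: I0; apply: leq_ltn_trans le_q _.
  by rewrite ltnS -addnBA // -addnA -[in leqRHS]addnA leq_add2l addnS
     -addSn subn1 prednK // addnC.
by rewrite [(i + m)%N]addnC -addnA subnKC // leq_add2r leq_addr.
Qed.

(** Any nonzero [x] generates [S], as its multiples form a nonzero submodule. *)
Lemma simple_fin_gen S : simple_module S -> fin_gen S.
Proof.
move=> [nz simS].
have [x x_neq0] : exists x : S, x <> 0.
  by apply: contrapT => noS; apply: nz => x; apply: contrapT => xn; apply: noS;
     exists x.
pose U : {pred S} := fun y => `[< exists c, y = c *: x >].
have U_closed : submod_closed U.
  split=> [|a _ _ /asboolP[c ->] /asboolP[c' ->]]; apply/asboolP.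
    by exists 0; rewrite scale0r.
  by exists (a * c + c'); rewrite scalerDl scalerA.
have [U0|UT] := simS U U_closed.
  by case: x_neq0; apply: U0; apply/asboolP; exists 1; rewrite scale1r.
exists 1%N, (fun=> x) => y; have /asboolP[c ->] := UT y.
by exists (fun=> c); rewrite big_ord1.
Qed.

Lemma sub_ddell_le_dell k M : fin_gen M -> (sub_ddell k M <= dell k M)%E.
Proof.
move=> fgM; rewrite [leRHS]/dell.
case: inf_natP => [m Qm _|_]; last by rewrite leey.
(* Row vectors of length 0 serve as the zero module in positive degrees. *)
pose D i : lmodType R := if i is 0%N then M else 'rV[R]_0.
have zeroD i : is_zero (D i.+1) by move=> x; apply/rowP => -[].
apply: inf_nat_le; exists 0%N, D, (idfun : {linear M -> D 0%N}).
exists (fun i => \0 : {linear D i -> D i.+1}); split=> //.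
- split; last by case.
  split=> // [y|i y]; first by split=> // _; exists y.
  by split=> // _; exists 0; rewrite [RHS]zeroD.
- case=> // i; exists 0%N, (fun=> 0) => x; exists (fun=> 0).
  by rewrite big_ord0 [LHS]zeroD.
by case=> // _; rewrite subn0; apply: inf_nat_le.
Qed.

End Modules.

Theorem mainTheorem5 (F : fieldType) (A : falgType F) (k : nat)
    (hk : (1 <= k)%N) :
  (alg_edell A k <= alg_sub_ddell A k)%E /\
  (alg_sub_ddell A k <= alg_dell A k)%E.
Proof.
split; apply: le_sup_simples => [M|S simS].
- by eexists.
- exact: edell_le_sub_ddell.
- by eexists.
- exact/sub_ddell_le_dell/simple_fin_gen.
Qed.
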